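(* Let $n\ge 3$ be an integer, let $R>0$, and let $T_n\subset\mathbb{R}^3$ be the solid with regular $n$-gonal base of inradius $R$ and height $R$ described in the context. Then the volume of $T_n$ is $$V=\frac{2}{3}\,n\,R^3\tan\left(\frac{\pi}{n}\right).$$
   Context: Let $P_n$ be the (filled) regular $n$-gon in the $xy$-plane centred at the origin, with inscribed circle of radius $R$. Consider the prism $P_n\times[0,R]$ and the inverted pyramid inside it with apex at the origin and base the top face $P_n\times\{R\}$, whose section at height $z\in[0,R]$ is $\frac{z}{R}P_n$. The prism with the pyramid removed is cut by planes parallel to the $xy$-plane into $m$ slices of equal thickness. Each slice is replaced by a slab of the same thickness and the same volume, whose horizontal cross-section is a regular $n$-gon concentric with and homothetic to $P_n$ (with centre on the $z$-axis). The slabs are stacked in the same order, and $T_n$ is the limiting solid as $m\to\infty$. Explicitly, $T_n$ is the set of points $(x,y,z)$ with $0\le z\le R$ and $(x,y)\in\lambda(z)P_n$, where $\lambda(z)\ge 0$ is determined by the equality of areas $\operatorname{area}(\lambda(z)P_n)=\operatorname{area}(P_n)-\operatorname{area}\left(\frac{z}{R}P_n\right)$. *)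

(* Defs.v *)
From HB Require Import structures.
From mathcomp Require Import all_boot all_order all_algebra.
From mathcomp Require Import all_classical all_reals all_analysis.

Set Implicit Arguments.
Unset Strict Implicit.
Unset Printing Implicit Defensive.

Import Order.TTheory GRing.Theory Num.Theory.
Import numFieldNormedType.Exports.

Local Open Scope classical_set_scope.
Local Open Scope ring_scope.

Section Solid.
Context {R : realType}.

(* Points of the plane are pairs (x, y), points of space are ((x, y), z). *)

Definition area (A : set (R * R)) : \bar R :=
  (@lebesgue_measure R \x @lebesgue_measure R)%E A.

Definition volume (A : set (R * R * R)) : \bar R :=
  (@lebesgue_measure R \x @lebesgue_measure R \x @lebesgue_measure R)%E A.

(* The k-th vertex of a regular n-gon centred at the origin, of circumradius
   rho; the phase phi accounts for its arbitrary orientation. Indices are to be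
   read modulo n, so that vertex n is vertex 0. *)
Definition vertex (n : nat) (rho phi : R) (k : nat) : R * R :=
  let t := phi + 2 * pi * k%:R / n%:R in (rho * cos t, rho * sin t).

(* Convex hull of the n vertices. *)
Definition regular_ngon (n : nat) (rho phi : R) : set (R * R) :=
  [set p | exists w : 'I_n -> R,
     [/\ forall k, 0 <= w k, \sum_(k < n) w k = 1 &
         p = \sum_(k < n) w k *: vertex n rho phi k]].

(* The segment from vertex k to vertex k.+1. *)
Definition side (n : nat) (rho phi : R) (k : nat) : set (R * R) :=
  [set p | exists2 t : R, 0 <= t <= 1 &
     p = (1 - t) *: vertex n rho phi k + t *: vertex n rho phi k.+1].

(* The Euclidean circle; the library norm on R * R is the sup norm. *)
Definition circle (r : R) : set (R * R) :=
  [set p | p.1 ^+ 2 + p.2 ^+ 2 = r ^+ 2].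

(* The circle lies in the polygon and touches each side at a single point. *)
Definition inscribed_circle (n : nat) (rho phi r : R) : Prop :=
  circle r `<=` regular_ngon n rho phi /\
  forall k : 'I_n, exists! p, (side n rho phi k `&` circle r) p.

Definition homothety (lam : R) (P : set (R * R)) : set (R * R) :=
  [set lam *: p | p in P].

(* The solid of height r whose section at height z is the copy lam P of P, with
   lam >= 0, of area equal to that of P minus (z / r) P. *)
Definition solid (P : set (R * R)) (r : R) : set (R * R * R) :=
  [set q | let z := q.2 in 0 <= z <= r /\
     exists lam : R, [/\ 0 <= lam,
       area (homothety lam P) = (area P - area (homothety (z / r) P))%E &
       homothety lam P q.1]].

End Solid.

(* Main.v *)
Require Import Defs.
From HB Require Import structures.
From mathcomp Require Import all_boot all_order all_algebra.
From mathcomp Require Import all_classical all_reals all_analysis.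
From mathcomp Require Import measurable_realfun ring lra.
Import Order.TTheory GRing.Theory Num.Theory.
Import numFieldNormedType.Exports.
Local Open Scope classical_set_scope.
Local Open Scope ring_scope.

(** The inscribed circle forces [r = rho * cos (pi / n)], so the convex hull of
    the vertices is the intersection of the [n] half-planes at distance [r] from
    the origin, and the homothety of ratio [lam] replaces [r] by [lam * r].  Up
    to the origin, the polygon of inradius [s] is the disjoint union of [n]
    rotated copies of a triangle of area [s ^+ 2 * tan (pi / n)]; rotations
    preserve area because they are products of shears.  The section of the solid
    at height [z] is therefore the polygon of inradius [sqrt (r ^+ 2 - z ^+ 2)],
    whose area is quadratic in [z], and integrating over [0 <= z <= r] gives the
    volume. *)

(** * Sections along the last coordinate *)

(** [area] unfolds to an integral over abscissas; the measure [\x^], which integrates over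
    ordinates, agrees with it on rectangles, and a product measure is determined by its values
    there. *)
Lemma area_ysection {R : realType} (A : set (R * R)) : measurable A ->
  (area A = \int[lebesgue_measure]_y lebesgue_measure (ysection A y))%E.
Proof.
move=> mA; apply: (product_measure_unique
  (m' := (lebesgue_measure \x^ lebesgue_measure)%E :
    {measure set _ -> \bar R})) => //.
by move=> X Y mX mY; exact: product_measure2E.
Qed.

(** Lets the plane area act as the first factor of a product measure in [volume_ysection]. The
    exhausting sequences are taken nondecreasing so that any two of their sets are covered at a
    common index. *)
Lemma sigma_finite_product_measure1 {d1 d2 : measure_display}
    {T1 : measurableType d1} {T2 : measurableType d2} {R : realType}
    (m1 : {sigma_finite_measure set T1 -> \bar R})
    (m2 : {sigma_finite_measure set T2 -> \bar R}) :
  sigma_finite setT (m1 \x m2)%E.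
Proof.
have /sigma_finiteP[F [FT ndF Foo]] := sigma_finiteT m1.
have /sigma_finiteP[G [GT ndG Goo]] := sigma_finiteT m2.
exists (fun n => F n `*` G n).
  apply/seteqP; split=> // -[x y] _.
  have [i _ Fx] : (\bigcup_i F i) x by rewrite -FT.
  have [j _ Gy] : (\bigcup_i G i) y by rewrite -GT.
  exists (maxn i j) => //; split.
    by move: x Fx; exact/subsetPset/ndF/leq_maxl.
  by move: y Gy; exact/subsetPset/ndG/leq_maxr.
move=> n; have [mF Fn] := Foo n; have [mG Gn] := Goo n.
split; first exact: measurableX.
by rewrite product_measure1E // lte_mul_pinfty // ge0_fin_numE.
Qed.

Lemma volume_ysection {R : realType} (A : set (R * R * R)) : measurable A ->
  (volume A = \int[lebesgue_measure]_z area (ysection A z))%E.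
Proof.
move=> mA.
pose m1 := (@lebesgue_measure R \x @lebesgue_measure R)%E.
pose sf := Measure_isSigmaFinite.Build _ _ _ m1
  (sigma_finite_product_measure1 _ _).
pose m12 : {sigma_finite_measure set _ -> \bar R} :=
  HB.pack m1 (Measure.class m1) sf.
pose m' := (m12 \x^ @lebesgue_measure R)%E : {measure set _ -> \bar R}.
apply: (product_measure_unique (m1 := m12) (m' := m')) => //.
by move=> X Y mX mY; exact: product_measure2E.
Qed.

(** * Invariance of area under shears and rotations *)

Lemma lebesgue_measure_translate {R : realType} (c : R) (A : set R) :
  measurable A ->
  lebesgue_measure ((fun x => x + c) @^-1` A) = lebesgue_measure A.
Proof.
move=> mA.
have mf : measurable_fun setT
    (fun x : measurableTypeR R => x + c : measurableTypeR R).
  exact: measurable_funD.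
apply/esym; apply: (@lebesgue_measure_unique _
  (pushforward lebesgue_measure
    (fun x : measurableTypeR R => x + c : measurableTypeR R))) => //.
move=> _ [[a b]] _ <-.
rewrite /pushforward /= [X in _ = lebesgue_measure X]
  (_ : _ = `](a - c), (b - c)]%classic); last first.
  by apply/seteqP; split=> x /=; rewrite !in_itv /= ltrBlDr lerBrDr.
rewrite !lebesgue_measure_itv /= !lte_fin ltrD2r.
by case: ifP => // _; rewrite -!EFinD; congr (_%:E); lra.
Qed.

(** The section at abscissa [x] is merely translated by a multiple of [x]. The other shear is
    treated likewise, with the sections of [area_ysection]. *)
Lemma area_shear_snd {R : realType} (c : R) (A : set (R * R)) : measurable A ->
  area [set p | A (p.1, p.2 + c * p.1)] = area A.
Proof.
move=> mA; rewrite /area /product_measure1; apply: eq_integral => x _ /=.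
rewrite -[RHS](lebesgue_measure_translate (c * x));
  last exact: measurable_xsection.
by rewrite !xsectionE.
Qed.

Lemma measurable_linear {R : realType} (a b c d : R) (A : set (R * R)) :
  measurable A ->
  measurable [set p : R * R | A (a * p.1 + b * p.2, c * p.1 + d * p.2)].
Proof.
move=> mA; rewrite -[X in measurable X]setTI.
have mf : measurable_fun setT
    (fun p : R * R => (a * p.1 + b * p.2, c * p.1 + d * p.2)).
  by apply: measurable_fun_pair; apply: measurable_funD;
    apply: measurable_funM => //.
exact: mf.
Qed.

Lemma area_shear_fst {R : realType} (c : R) (A : set (R * R)) : measurable A ->
  area [set p | A (p.1 + c * p.2, p.2)] = area A.
Proof.
move=> mA; rewrite !area_ysection //; last first.
  rewrite [X in measurable X](_ : _ =
    [set p : R * R | A (1 * p.1 + c * p.2, 0 * p.1 + 1 * p.2)]).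
    exact: measurable_linear.
  by apply/seteqP; split => p /=; rewrite !mul1r mul0r add0r.
apply: eq_integral => y _ /=.
rewrite -[RHS](lebesgue_measure_translate (c * y));
  last exact: measurable_ysection.
by rewrite !ysectionE.
Qed.

Lemma area_rotation {R : realType} (c s : R) (A : set (R * R)) :
  c ^+ 2 + s ^+ 2 = 1 -> measurable A ->
  area [set p | A (c * p.1 - s * p.2, s * p.1 + c * p.2)] = area A.
Proof.
(* For [s' != 0] the rotation is the product of three shears; the half turn and
   the identity are products of two such rotations. *)
have shears (c' s' : R) (B : set (R * R)) :
    s' != 0 -> c' ^+ 2 + s' ^+ 2 = 1 -> measurable B ->
    area [set p | B (c' * p.1 - s' * p.2, s' * p.1 + c' * p.2)] = area B.
  (* For [c' = cos u] and [s' = sin u], [e] is [- tan (u / 2)]: the rotation is a horizontal shear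
     of ratio [e], a vertical one of ratio [s'], and the first one again. *)
  move=> s0 cs mB; pose e := (c' - 1) / s'.
  have mB1 : measurable [set p : R * R | B (p.1 + e * p.2, p.2)].
    rewrite [X in measurable X](_ : _ =
      [set p : R * R | B (1 * p.1 + e * p.2, 0 * p.1 + 1 * p.2)]).
      exact: measurable_linear.
    by apply/seteqP; split => p /=; rewrite !mul1r mul0r add0r.
  have mB2 : measurable
      [set p : R * R | B (p.1 + e * (p.2 + s' * p.1), p.2 + s' * p.1)].
    rewrite [X in measurable X](_ : _ = [set p : R * R |
       [set p : R * R | B (p.1 + e * p.2, p.2)]
         (1 * p.1 + 0 * p.2, s' * p.1 + 1 * p.2)]).
      exact: measurable_linear.
    by apply/seteqP; split => p /=;
      rewrite !mul1r mul0r addr0 [s' * _ + _]addrC.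
  rewrite -[RHS](area_shear_fst e) // -[RHS](area_shear_snd s') //
    -[RHS](area_shear_fst e) //.
  congr area; apply/seteqP.
  have E (p : R * R) : (c' * p.1 - s' * p.2, s' * p.1 + c' * p.2) =
     (p.1 + e * p.2 + e * (p.2 + s' * (p.1 + e * p.2)),
       p.2 + s' * (p.1 + e * p.2)).
    have ee : e * s' = c' - 1 by rewrite /e mulfVK.
    have e2 : e * (1 + c') = - s'.
      by apply: (mulIf s0); rewrite mulrAC ee; nra.
    congr pair; [|nra].
    transitivity (p.1 + e * s' * p.1 + p.2 * (e * (2 + (e * s'))));
      last by ring.
    by rewrite ee (_ : 2 + (c' - 1) = 1 + c') ?e2; ring.
  by split=> p /=; rewrite E.
move=> cs mA; have [s0|] := eqVneq s 0; last by move=> s0; exact: shears.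
have mB : measurable [set p : R * R | A (- p.2, p.1)].
  rewrite [X in measurable X](_ : _ =
    [set p : R * R | A (0 * p.1 + -1 * p.2, 1 * p.1 + 0 * p.2)]).
    exact: measurable_linear.
  by apply/seteqP; split => p /=; rewrite !mul1r !mul0r addr0 add0r mulN1r.
(* Here [c] is 1 or -1, and [c] times the identity is the product of the quarter turns of sines [1]
   and [- c]. *)
rewrite -[RHS](shears 0 1) ?oner_neq0 //; last by rewrite expr0n expr1n add0r.
under [X in _ = area X]eq_set do rewrite !mul0r !mul1r add0r addr0.
rewrite -[RHS](shears 0 (- c)) //.
- by congr (area _); apply/seteqP; split=> p /=;
    rewrite s0 !(mul0r, mulNr, add0r, addr0, subr0, opprK).
- apply/eqP => c0; move: cs; rewrite s0 -[c]opprK c0 oppr0 expr0n add0r.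
  by move=> /esym/eqP; rewrite oner_eq0.
- by rewrite expr0n sqrrN add0r -cs s0 expr0n addr0.
Qed.

(** * Integrals of polynomials and the area of a wedge *)

Lemma integral_deriv_poly {R : realType} (p : {poly R}) (a b : R) : a <= b ->
  (\int[lebesgue_measure]_(x in `[a, b]) (p^`().[x])%:E = (p.[b] - p.[a])%:E)%E.
Proof.
rewrite le_eqVlt => /predU1P[->|ab].
  by rewrite set_itv1 integral_set1 subrr.
rewrite (continuous_FTC2 (F := horner p)) //.
- by apply: continuous_subspaceT; exact: continuous_horner.
- split; first by move=> x _; exact: derivable_horner.
  + by apply: cvg_at_right_filter; exact: continuous_horner.
  + by apply: cvg_at_left_filter; exact: continuous_horner.
- by move=> x _; rewrite derivE.
Qed.

(* Half-open, so that the copies of a wedge filling the polygon are disjoint. *)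
Definition wedge {R : realType} (t s : R) : set (R * R) :=
  [set q | 0 < q.1 <= s /\ - (t * q.1) <= q.2 < t * q.1].

Lemma measurable_set_ltr {d : measure_display} {T : measurableType d}
    {R : realType} (f g : T -> R) :
  measurable_fun setT f -> measurable_fun setT g ->
  measurable [set x | f x < g x].
Proof.
move=> mf mg; rewrite -[X in measurable X]setTI.
by apply: (measurable_fun_ltr mf mg measurableT (Y := [set true])).
Qed.

Lemma measurable_set_ler {d : measure_display} {T : measurableType d}
    {R : realType} (f g : T -> R) :
  measurable_fun setT f -> measurable_fun setT g ->
  measurable [set x | f x <= g x].
Proof.
move=> mf mg; rewrite -[X in measurable X]setTI.
by apply: (measurable_fun_ler mf mg measurableT (Y := [set true])).
Qed.

Lemma measurable_wedge {R : realType} (t s : R) : measurable (wedge t s).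
Proof.
have mt : measurable_fun setT (fun q : R * R => t * q.1).
  exact: measurable_funM.
rewrite (_ : wedge t s =
    [set q | 0 < q.1] `&` [set q | q.1 <= s] `&`
    ([set q | - (t * q.1) <= q.2] `&` [set q | q.2 < t * q.1])); last first.
  apply/seteqP; split=> q /=; first by case=> /andP[? ?] /andP[? ?].
  by move=> [[? ?] [? ?]]; split; apply/andP.
apply: measurableI; apply: measurableI.
- exact: measurable_set_ltr.
- exact: measurable_set_ler.
- by apply: measurable_set_ler => //; exact: measurable_funN.
- exact: measurable_set_ltr.
Qed.

Lemma area_wedge {R : realType} (t s : R) : 0 <= t -> 0 <= s ->
  area (wedge t s) = (s ^+ 2 * t)%:E.
Proof.
move=> t0 s0.
rewrite /area /product_measure1.
transitivity (\int[lebesgue_measure]_(x in `[0%R, s]) (2 * t * x)%:E)%E.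
  rewrite [RHS]integral_mkcond; apply: eq_integral => x _ /=.
  rewrite patchE; case: ifPn => [|].
    rewrite inE /= in_itv /= => /andP[x0 xs].
    (* This includes [x = 0], where the wedge has no point and the half-open interval is empty as
       well. *)
    have -> : xsection (wedge t s) x = `[- (t * x), t * x[%classic.
      rewrite xsectionE /wedge; apply/seteqP; split=> y /=; rewrite in_itv /=.
        by case.
      move=> /andP[y1 y2]; split; last by apply/andP.
      rewrite xs andbT lt_neqAle x0 andbT; apply/eqP => x00.
      by move: (le_lt_trans y1 y2); rewrite -x00 mulr0 oppr0 ltxx.
    rewrite lebesgue_measure_itv /= lte_fin.
    case: ltP => [_|]; first by rewrite -EFinD; congr (_%:E); lra.
    by have tx := mulr_ge0 t0 x0 => le; congr (_%:E); lra.
  rewrite notin_setE /= in_itv /= => nx.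
  rewrite (_ : xsection _ _ = set0) ?measure0 //.
  rewrite xsectionE; apply/seteqP; split => // y [/= /andP[x0 xs] _].
  by apply: nx; rewrite ltW.
have -> : (fun x : R => (2 * t * x)%:E) = (fun x => ((t *: 'X^2)^`().[x])%:E).
  apply/funext => x; congr (_%:E).
  by rewrite derivZ derivXn hornerZ hornerMn hornerXn expr1; ring.
by rewrite integral_deriv_poly // !hornerZ !hornerXn; congr (_%:E); ring.
Qed.

(** * Polar coordinates and the directions of the sides *)

(** [1 - cos x] is twice the square of [sin (x / 2)], and [x / 2] lies strictly between 0 and [pi].
    This will separate the sectors. *)
Lemma cos_lt1 {R : realType} (x : R) : 0 < x < 2 * pi -> cos x < 1.
Proof.
move=> /andP[x0 xpi].
have s0 : 0 < sin (x / 2) by apply: sin_gt0_pi; apply/andP; split; lra.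
rewrite (_ : x = (x / 2) *+ 2) ?cos_mulr2n ?cos2sin2;
  last by rewrite mulr2n; lra.
have := exprn_gt0 2 s0; lra.
Qed.

Lemma cosD2pi_int {R : realType} (x : R) (q : int) :
    cos (x + 2 * pi * q%:~R) = cos x.
Proof.
have E (y : R) (m : nat) : cos (y + 2 * pi * m%:R) = cos y.
  rewrite -(periodicn (@cosD2pi R) m y); congr cos;
    rewrite mulr_natr mulr_natl; ring.
case: q => m; first exact: E.
by rewrite NegzE mulrNz -(E _ m.+1) -pmulrn mulrN subrK.
Qed.

Lemma sinD2pi_int {R : realType} (x : R) (q : int) :
    sin (x + 2 * pi * q%:~R) = sin x.
Proof. by rewrite -!cosBpihalf addrAC cosD2pi_int. Qed.

Definition polar {R : realType} (rho a : R) : R * R :=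
  (rho * cos a, rho * sin a).

Lemma polar_exists {R : realType} (p : R * R) : p != 0 ->
  exists rho a : R, 0 < rho /\ p = polar rho a.
Proof.
move=> p0; pose rho := Num.sqrt (p.1 ^+ 2 + p.2 ^+ 2).
have pp : 0 < p.1 ^+ 2 + p.2 ^+ 2.
  rewrite lt_neqAle addr_ge0 ?sqr_ge0 // andbT eq_sym paddr_eq0 ?sqr_ge0 //
    !sqrf_eq0.
  by apply: contra p0 => /andP[/eqP p1 /eqP p2];
    rewrite [p]surjective_pairing p1 p2.
have rho0 : 0 < rho by rewrite sqrtr_gt0.
have rho2 : rho ^+ 2 = p.1 ^+ 2 + p.2 ^+ 2 by rewrite sqr_sqrtr // ltW.
have c1 : -1 <= p.1 / rho <= 1.
  by rewrite -ler_norml normrM normfV (gtr0_norm rho0) ler_pdivrMr // mul1r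
     -[leRHS](gtr0_norm rho0) -ler_sqr ?nnegrE // !real_normK ?num_real // rho2
       lerDl sqr_ge0.
have e1 : rho * cos (acos (p.1 / rho)) = p.1.
  by rewrite acosK ?in_itv //= mulrC divfK ?gt_eqF.
have e2 : rho * sin (acos (p.1 / rho)) = `|p.2|.
  rewrite sin_acos // -{1}(gtr0_norm rho0) -sqrtr_sqr -sqrtrM ?sqr_ge0 //
    -sqrtr_sqr; congr Num.sqrt.
  by rewrite mulrBr mulr1 -exprMn (mulrC rho) divfK ?gt_eqF // rho2 addrC addKr.
(* [acos] only yields angles of the upper half-plane, so the sign of the ordinate decides between it
   and its opposite. *)
have [p2|p2] := leP 0 p.2.
  exists rho, (acos (p.1 / rho)); split => //.
  by rewrite /polar e1 e2 ger0_norm //; case: (p).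
exists rho, (- acos (p.1 / rho)); split => //.
rewrite /polar cosN sinN mulrN e1 e2 ltr0_norm // opprK; by case: (p).
Qed.

(** The direction of the outward normal to side [k], half way between those of the vertices [k] and
    [k.+1]. *)
Definition normal_angle {R : realType} (n : nat) (phi : R) (k : nat) : R :=
  phi + (2 * k%:R + 1) * (pi / n%:R).

(** With [v = m * (pi / n)], the difference of the two cosines is [2 * sin v * sin (d + v)]; for [m]
    positive, both [v] and [d + v] lie in [[0, pi]]. *)
Lemma cos_shift_le {R : realType} (n m : nat) (d : R) : (m < n)%N ->
  - (pi / n%:R) <= d <= pi / n%:R ->
  cos (d + 2 * m%:R * (pi / n%:R)) <= cos d.
Proof.
move=> mn /andP[d1 d2]; case: m mn => [|m] mn;
  first by rewrite mulr0 mul0r addr0.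
set a := pi / n%:R in d1 d2 *; set v := m.+1%:R * a.
have n0 : 0 < n%:R :> R by rewrite ltr0n (ltn_trans _ mn).
have a0 : 0 < a by rewrite divr_gt0 ?pi_gt0.
have an : n%:R * a = pi by rewrite mulrC divfK ?gt_eqF.
have v1 : a <= v by apply: ler_peMl; [exact: ltW|rewrite ler1n].
have v2 : v + a <= pi.
  rewrite -an -[X in _ + X]mul1r -mulrDl natr1.
  by apply: ler_wpM2r; [exact: ltW|rewrite ler_nat].
have s1 : 0 <= sin v by apply: sin_ge0_pi; apply/andP; split; lra.
have s2 : 0 <= sin (d + v) by apply: sin_ge0_pi; apply/andP; split; lra.
have -> : d + 2 * m.+1%:R * a = (d + v) + v by rewrite /v; ring.
have {2}-> : d = (d + v) - v by ring.
rewrite cosD cosB; have := mulr_ge0 s2 s1; lra.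
Qed.

(** Among the half-planes bounding the polygon, the tightest one in a given direction is that of the
    nearest normal. Parity of the cosine reduces the case [j < i] to [cos_shift_le]. *)
Lemma cos_normal_le {R : realType} (n : nat) (phi d : R) (i j : 'I_n) :
  - (pi / n%:R) <= d <= pi / n%:R ->
  cos (normal_angle n phi j + d - normal_angle n phi i) <= cos d.
Proof.
move=> dn; rewrite /normal_angle; set a := pi / n%:R.
have [ij|/ltnW ji] := leqP i j.
  rewrite (_ : _ - _ = d + 2 * (j - i)%:R * a); last by rewrite natrB //; ring.
  by apply: cos_shift_le => //; rewrite (leq_ltn_trans (leq_subr _ _)).
rewrite -(cosN d) -[leLHS]cosN (_ : - (_ - _) = - d + 2 * (i - j)%:R * a);
  last by rewrite natrB //; ring.
apply: cos_shift_le; first by rewrite (leq_ltn_trans (leq_subr _ _)).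
by case/andP: dn => d1 d2; rewrite lerN2 d2 lerNl d1.
Qed.

(** Count angles from [phi] in units of [2 * pi / n] and take the integer part: its residue modulo
    [n] is the index [k], its quotient a number of full turns, and the fractional part, recentred by
    [pi / n], gives [d]. *)
Lemma sector_exists {R : realType} (n : nat) (phi th : R) : (0 < n)%N ->
  exists (k : 'I_n) (d : R), - (pi / n%:R) <= d < pi / n%:R /\
    forall rho, polar rho th = polar rho (normal_angle n phi k + d).
Proof.
move=> n0; pose a : R := pi / n%:R.
have n0R : 0 < n%:R :> R by rewrite ltr0n.
have a0 : 0 < a by rewrite divr_gt0 ?pi_gt0.
have an : a * n%:R = pi by rewrite divfK ?gt_eqF.
pose u := (th - phi) / (2 * a); pose K := Num.floor u.
have [/= f1 f2] : K%:~R <= u /\ u < (K + 1)%:~R.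
  by have := floor_itv u; rewrite -/K => /andP[].
have uE : th = phi + 2 * a * u by rewrite /u; field; rewrite gt_eqF.
have kn : (absz (K %% n)%Z < n)%N.
  by rewrite -ltz_nat gez0_abs ?modz_ge0 ?ltz_pmod // gt_eqF.
have KE : K%:~R = (K %/ n)%Z%:~R * n%:R + (absz (K %% n)%Z)%:R :> R.
  rewrite {1}(divz_eq K n) intrD intrM; congr (_ + _).
  by rewrite -[RHS]/((absz (K %% n)%Z)%:~R) gez0_abs // modz_ge0 // gt_eqF.
exists (Ordinal kn), (2 * a * (u - K%:~R) - a); split.
  rewrite -/a; move: f2; rewrite intrD => f2.
  have : 0 <= a * (u - K%:~R) by rewrite mulr_ge0 ?subr_ge0 // ltW.
  have : 0 < a * (1 - (u - K%:~R)) by rewrite mulr_gt0 //; lra.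
  by move=> *; apply/andP; split; lra.
move=> rho.
have -> : th = normal_angle n phi (Ordinal kn) +
    (2 * a * (u - K%:~R) - a) + 2 * pi * (K %/ n)%Z%:~R.
  by rewrite /normal_angle /= -/a -an KE {1}uE; ring.
by rewrite /polar cosD2pi_int sinD2pi_int.
Qed.

(** The tangent increases on []-pi/2, pi/2[], so bounding the slope of [q] by [tan a] amounts to
    bounding its polar angle by [a]. *)
Lemma wedgeP {R : realType} (a s : R) (q : R * R) : 0 < a < pi / 2 ->
  wedge (tan a) s q <-> exists rho d, [/\ 0 < rho, - a <= d < a,
    rho * cos d <= s & q = polar rho d].
Proof.
move=> /andP[a0 api].
have itvP (x : R) : - a <= x <= a -> x \in `](- (pi / 2)), (pi / 2)[.
  by move=> /andP[x1 x2]; rewrite in_itv /=; apply/andP; split; lra.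
have ia : a \in `](- (pi / 2)), (pi / 2)[.
  by apply: itvP; apply/andP; split; lra.
have iNa : - a \in `](- (pi / 2)), (pi / 2)[.
  by apply: itvP; apply/andP; split; lra.
split=> [[/andP[x0 xs] /andP[y1 y2]]|[rho [d [rho0 /andP[d1 d2] ds ->]]]].
  set t := q.2 / q.1.
  have id : atan t \in `](- (pi / 2)), (pi / 2)[.
    by rewrite in_itv /= atan_gtNpi2 atan_ltpi2.
  have c0 : 0 < cos (atan t) by apply: cos_gt0_pihalf; move: id; rewrite in_itv.
  exists (q.1 / cos (atan t)), (atan t); split.
  - exact: divr_gt0.
  - apply/andP; split.
      by rewrite leNgt -ltr_tan // atanK tanN -leNgt /t ler_pdivlMr // mulNr.
    by rewrite -ltr_tan // atanK /t ltr_pdivrMr.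
  - by rewrite divfK // gt_eqF.
  - rewrite /polar divfK ?gt_eqF // -mulrA [_^-1 * _]mulrC -/(tan _) atanK /t
      mulrC divfK ?gt_eqF //.
    by case: (q).
have id : d \in `](- (pi / 2)), (pi / 2)[.
  by apply: itvP; apply/andP; split; lra.
have c0 : 0 < cos d by apply: cos_gt0_pihalf; move: id; rewrite in_itv.
have E : rho * sin d = tan d * (rho * cos d).
  by rewrite /tan; field; rewrite gt_eqF.
have rc : 0 < rho * cos d by rewrite mulr_gt0.
split; first by rewrite /= rc.
rewrite /= E -mulNr -tanN ler_pM2r // ltr_pM2r // ltr_tan // d2 andbT.
by rewrite leNgt ltr_tan // -leNgt.
Qed.

(** * Sectors, and the polygon they make up *)

(** The wedge turned by [b], as its preimage under the rotation of angle [- b]; the sine [- sin b]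
    is kept in the shape expected by [area_rotation]. *)
Definition sector {R : realType} (n : nat) (phi s : R) (k : nat) :
    set (R * R) :=
  let b := normal_angle n phi k in
  [set p | wedge (tan (pi / n%:R)) s
    (cos b * p.1 - (- sin b) * p.2, (- sin b) * p.1 + cos b * p.2)].

Lemma pi_div_bounds {R : realType} (n : nat) : (3 <= n)%N ->
  0 < (pi : R) / n%:R < pi / 2.
Proof.
move=> n3; have n0 : 0 < n%:R :> R by rewrite ltr0n (ltn_trans _ n3).
rewrite divr_gt0 ?pi_gt0 //= ltr_pM2l ?pi_gt0 // ltf_pV2 ?posrE //.
by rewrite ltr_nat.
Qed.

Lemma tan_pi_div_gt0 {R : realType} (n : nat) : (3 <= n)%N ->
  0 < tan (pi / n%:R) :> R.
Proof.
move=> n3; have /andP[a0 api] := @pi_div_bounds R n n3.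
rewrite /tan divr_gt0 //.
  by apply: sin_gt0_pi; apply/andP; split; have := pi_gt0 R; lra.
by apply: cos_gt0_pihalf; apply/andP; split; lra.
Qed.

Lemma sectorP {R : realType} (n : nat) (phi s : R) (k : nat) (p : R * R) :
  (3 <= n)%N ->
  sector n phi s k p <-> exists rho d, [/\ 0 < rho,
    - (pi / n%:R) <= d < pi / n%:R, rho * cos d <= s &
    p = polar rho (normal_angle n phi k + d)].
Proof.
move=> n3; rewrite /sector /=; set b := normal_angle n phi k.
have cs := cos2Dsin2 b.
split=> [/(wedgeP _ _ _ (pi_div_bounds n n3))|] [rho [d [rho0 dn ds E]]].
  exists rho, d; split => //; move: E => [E1 E2].
  rewrite [p]surjective_pairing /polar cosD sinD; congr pair.
    transitivity (cos b * (rho * cos d) - sin b * (rho * sin d)); last by ring.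
    rewrite -E1 -E2; transitivity (p.1 * (cos b ^+ 2 + sin b ^+ 2));
      last by ring.
    by rewrite cs mulr1.
  transitivity (sin b * (rho * cos d) + cos b * (rho * sin d)); last by ring.
  rewrite -E1 -E2; transitivity (p.2 * (cos b ^+ 2 + sin b ^+ 2)); last by ring.
  by rewrite cs mulr1.
apply/(wedgeP _ _ _ (pi_div_bounds n n3)); exists rho, d; split => //.
rewrite E /polar cosD sinD /=; congr pair.
  transitivity (rho * cos d * (cos b ^+ 2 + sin b ^+ 2)); first by ring.
  by rewrite cs mulr1.
transitivity (rho * sin d * (cos b ^+ 2 + sin b ^+ 2)); first by ring.
by rewrite cs mulr1.
Qed.

Lemma measurable_sector {R : realType} (n : nat) (phi s : R) (k : nat) :
  measurable (sector n phi s k).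
Proof.
rewrite /sector; under eq_set do rewrite mulNr opprK.
apply: measurable_linear; exact: measurable_wedge.
Qed.

Lemma area_sector {R : realType} (n : nat) (phi s : R) (k : nat) :
  (3 <= n)%N -> 0 <= s ->
  area (sector n phi s k) = (s ^+ 2 * tan (pi / n%:R))%:E.
Proof.
move=> n3 s0; rewrite /sector area_rotation ?sqrrN ?cos2Dsin2 //.
  by rewrite area_wedge // ltW // tan_pi_div_gt0.
exact: measurable_wedge.
Qed.

(** As the angular ranges are half-open, polar angles taken in sectors [i < j] differ by strictly
    more than 0 and less than [2 * pi], whereas a common point would make the cosine of the
    difference equal to 1. *)
Lemma trivIset_sector {R : realType} (n : nat) (phi s : R) : (3 <= n)%N ->
  trivIset setT (fun k : 'I_n => sector n phi s k).
Proof.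
move=> n3; have /andP[a0 api] := @pi_div_bounds R n n3.
have an : pi / n%:R * n%:R = pi :> R.
  by rewrite divfK // pnatr_eq0 -lt0n (ltn_trans _ n3).
have disj (i j : 'I_n) (p : R * R) : (i < j)%N ->
    ~ (sector n phi s i p /\ sector n phi s j p).
  move=> ij [/(sectorP _ _ _ _ _ n3)[r1 [d1 [r10 /andP[d11 d12] _ E1]]]].
  move=> /(sectorP _ _ _ _ _ n3)[r2 [d2 [r20 /andP[d21 d22] _ E2]]].
  set b1 := normal_angle n phi i + d1 in E1.
  set b2 := normal_angle n phi j + d2 in E2.
  have cos1 : cos (b2 - b1) < 1.
    apply: cos_lt1.
    rewrite (_ : b2 - b1 = d2 - d1 + 2 * (pi / n%:R) * (j - i)%:R); last first.
      by rewrite /b2 /b1 /normal_angle (natrB _ (ltnW ij)); ring.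
    have l1 : 1 <= (j - i)%:R :> R by rewrite ler1n subn_gt0.
    have l2 : (j - i)%:R + 1 <= n%:R :> R.
      by rewrite natr1 ler_nat (leq_ltn_trans (leq_subr _ _)).
    have := ler_wpM2l (ltW a0) l1; have := ler_wpM2l (ltW a0) l2.
    rewrite mulrDr an !mulr1 => *; apply/andP; split; lra.
  have [e1 e2] : polar r1 b1 = polar r2 b2 by rewrite -E1 -E2.
  have c1 := cos2Dsin2 b1; have c2 := cos2Dsin2 b2.
  have sq : r1 ^+ 2 = r2 ^+ 2.
    rewrite -[LHS]mulr1 -c1 -[RHS]mulr1 -c2 !mulrDr -!exprMn.
    by rewrite e1 e2.
  have rr : r1 = r2.
    by apply/eqP; rewrite -(eqrXn2 (ltn0Sn 1)) ?ltW //; apply/eqP.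
  have r1n0 : r1 != 0 by rewrite gt_eqF.
  have c12 : cos b1 = cos b2 by apply: (mulfI r1n0); rewrite e1 rr.
  have s12 : sin b1 = sin b2 by apply: (mulfI r1n0); rewrite e2 rr.
  by move: cos1; rewrite cosB -c12 -s12 -!expr2 c1 ltxx.
apply/trivIsetP => i j _ _ ij; apply/seteqP; split => // p sij.
move: ij; rewrite -val_eqE neq_ltn => /orP[] l; first exact: (disj _ _ p l).
by apply: (disj _ _ p l); case: sij.
Qed.

(* A description by half-planes, in which homotheties only rescale [s]. *)
Definition polygon {R : realType} (n : nat) (phi s : R) : set (R * R) :=
  [set p | forall k : 'I_n, let b := normal_angle n phi k in
     p.1 * cos b + p.2 * sin b <= s].

(** For a point whose direction is nearest to normal [k], the [k]-th half-plane is exactly the bound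
    defining sector [k], and by [cos_normal_le] it implies all the others. *)
Lemma polygon_sectors {R : realType} (n : nat) (phi s : R) : (3 <= n)%N ->
  0 <= s ->
  polygon n phi s = [set 0] `|` \big[setU/set0]_(k < n) sector n phi s k.
Proof.
move=> n3 s0; apply/seteqP; split=> [p Hp|p].
  have [->|/polar_exists[rho [th [rho0 pE]]]] := eqVneq p 0; [by left|right].
  have [k [d [dn E]]] := sector_exists n phi th (ltn_trans (ltn0Sn 1) n3).
  rewrite -(bigcup_mkord n (fun k => sector n phi s k)); exists k => /=;
    first exact: ltn_ord.
  apply/(sectorP _ _ _ _ _ n3); exists rho, d; split => //; last by rewrite pE.
  apply: le_trans (Hp k); rewrite pE E /polar /=; set b := normal_angle _ _ _.
  rewrite (_ : cos d = cos (b + d) * cos b + sin (b + d) * sin b).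
    by rewrite mulrDr !mulrA.
  by rewrite -cosB; congr cos; ring.
move=> [->|]; first by move=> k /=; rewrite !mul0r addr0.
rewrite -(bigcup_mkord n (fun k => sector n phi s k)) => -[k /= kn].
move=> /(sectorP _ _ _ _ _ n3)[rho [d [rho0 /andP[d1 d2] ds ->]]] i.
rewrite /=; apply: le_trans ds; rewrite -!mulrA -mulrDr -cosB ler_pM2l //.
by apply: (cos_normal_le n phi d i (Ordinal kn)); rewrite d1 ltW.
Qed.

Lemma set1_pair0 {R : realType} : [set 0 : R * R] = [set 0] `*` [set 0].
Proof. by apply/seteqP; split=> [p ->|[x y] /= [-> ->]]. Qed.

(** Settles the homothety of ratio 0, which cannot be inverted to rescale the half-planes. *)
Lemma polygon0 {R : realType} (n : nat) (phi : R) : (3 <= n)%N ->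
  polygon n phi 0 = [set 0].
Proof.
move=> n3; rewrite polygon_sectors // big1 ?setU0 // => k _.
apply/seteqP; split=> // p [/andP[p1 p2] _].
by move: (lt_le_trans p1 p2); rewrite ltxx.
Qed.

Lemma area_polygon {R : realType} (n : nat) (phi s : R) : (3 <= n)%N ->
  0 <= s -> area (polygon n phi s) = (n%:R * s ^+ 2 * tan (pi / n%:R))%:E.
Proof.
move=> n3 s0; rewrite polygon_sectors //.
have mS (k : 'I_n) : measurable (sector n phi s k) by exact: measurable_sector.
rewrite /area measureU.
- rewrite measure_bigsetU_ord //; last exact: trivIset_sector.
  rewrite -[RHS]add0e; congr (_ + _)%E.
    by rewrite set1_pair0 [LHS]product_measure1E //= lebesgue_measure_set1
      mul0e.
  rewrite (eq_bigr (fun=> (s ^+ 2 * tan (pi / n%:R))%:E)); last first.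
    by move=> k _; exact: area_sector.
  by rewrite sumEFin sumr_const card_ord -mulrA mulr_natl.
- by rewrite set1_pair0; exact: measurableX.
- by apply: bigsetU_measurable => k _; exact: mS.
- apply/seteqP; split=> // p [/= -> ].
  rewrite -(bigcup_mkord n (fun k => sector n phi s k)) => -[k _].
  by rewrite /sector /wedge /= !mulr0 subr0 ltxx => -[].
Qed.

Lemma homothety_polygon {R : realType} (n : nat) (phi s lam : R) : (3 <= n)%N ->
  0 <= s -> 0 <= lam ->
  homothety lam (polygon n phi s) = polygon n phi (lam * s).
Proof.
move=> n3 s0; rewrite le_eqVlt => /predU1P[<-|l0].
  rewrite mul0r polygon0 //; apply/seteqP; split=> [p [q _ <-]|p ->].
    by rewrite scale0r.
  by exists 0; [move=> k /=; rewrite !mul0r addr0|rewrite scale0r].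
apply/seteqP; split=> [_ [q Hq <-] k /=|p Hp].
  by rewrite -!mulrA -mulrDr ler_pM2l //; exact: Hq.
exists (lam^-1 *: p); last by rewrite scalerA divff ?gt_eqF // scale1r.
move=> k /=; rewrite -!mulrA -mulrDr -(ler_pM2l l0) mulrA divff ?gt_eqF //
  mul1r.
exact: Hp.
Qed.

(** * The convex hull of the vertices as an intersection of half-planes *)

Lemma vertex_polar {R : realType} (n : nat) (rho phi : R) (k : nat) :
  vertex n rho phi k = polar rho (normal_angle n phi k - pi / n%:R).
Proof.
have -> : normal_angle n phi k - pi / n%:R = phi + 2 * pi * k%:R / n%:R.
  by rewrite /normal_angle; ring.
by [].
Qed.

Lemma vertexS_polar {R : realType} (n : nat) (rho phi : R) (k : nat) :
  vertex n rho phi k.+1 = polar rho (normal_angle n phi k + pi / n%:R).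
Proof.
have -> : normal_angle n phi k + pi / n%:R = phi + 2 * pi * k.+1%:R / n%:R.
  by rewrite /normal_angle -natr1; ring.
by [].
Qed.

Lemma sum_scale_pair {R : realType} (n : nat) (w : 'I_n -> R)
    (v : 'I_n -> R * R) :
  \sum_(k < n) w k *: v k =
    (\sum_(k < n) w k * (v k).1, \sum_(k < n) w k * (v k).2).
Proof. by elim/big_rec3: _ => // k x y z _ ->. Qed.

(** Half-planes are convex, so it suffices to test the vertices; vertex [i] is at angle [- (pi / n)]
    from normal [i], where [cos_normal_le] applies. *)
Lemma regular_ngon_sub_polygon {R : realType} (n : nat) (rho phi : R) :
    0 <= rho ->
  regular_ngon n rho phi `<=` polygon n phi (rho * cos (pi / n%:R)).
Proof.
move=> rho0 p [w [w0 w1 ->]] k; cbv zeta.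
set b := normal_angle n phi k.
have vb (i : 'I_n) :
    (vertex n rho phi i).1 * cos b + (vertex n rho phi i).2 * sin b <=
    rho * cos (pi / n%:R).
  rewrite vertex_polar /polar /= -!mulrA -mulrDr -cosB; apply: ler_wpM2l => //.
  have a0 : 0 <= pi / n%:R :> R by rewrite divr_ge0 ?pi_ge0.
  by rewrite -[leRHS]cosN; apply: (cos_normal_le n phi (- (pi / n%:R)) k i);
    apply/andP; split; lra.
move: (vertex n rho phi) vb => v vb.
rewrite sum_scale_pair !mulr_suml -big_split /=.
rewrite -[leRHS]mul1r -[X in _ <= X * _]w1 mulr_suml; apply: ler_sum => i _.
rewrite -!mulrA -mulrDr; apply: ler_wpM2l; [exact: w0|exact: vb].
Qed.

Lemma scale_pairE {R : realType} (a : R) (p : R * R) :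
  a *: p = (a * p.1, a * p.2).
Proof. by []. Qed.

(** The missing weight [1 - a - b] is carried by a convex combination of the vertices equal to 0. *)
Lemma regular_ngon_comb {R : realType} (n : nat) (rho phi a b : R)
    (p q : R * R) :
  regular_ngon n rho phi 0 -> regular_ngon n rho phi p ->
  regular_ngon n rho phi q ->
  0 <= a -> 0 <= b -> a + b <= 1 -> regular_ngon n rho phi (a *: p + b *: q).
Proof.
move=> [w0 [w0p w01 w00]] [w1 [w1p w11 ->]] [w2 [w2p w21 ->]] a0 b0 ab.
exists (fun k => a * w1 k + b * w2 k + (1 - a - b) * w0 k); split.
- move=> k; rewrite !addr_ge0 ?mulr_ge0 //; lra.
- by rewrite !big_split /= -!mulr_sumr w01 w11 w21; ring.
- under [RHS]eq_bigr do rewrite 2!scalerDl -!scalerA.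
  by rewrite !big_split /= -!scaler_sumr -w00 scaler0 addr0.
Qed.

Lemma vertex_regular_ngon {R : realType} (n : nat) (rho phi : R) (k : nat) :
  (k < n)%N -> regular_ngon n rho phi (vertex n rho phi k).
Proof.
move=> kn; pose i := Ordinal kn; exists (fun j => (j == i)%:R); split.
- by move=> j; exact: ler0n.
- by rewrite (bigD1 i) //= eqxx big1 ?addr0 // => j /negPf ->.
- rewrite (bigD1 i) //= eqxx scale1r big1 ?addr0 // => j /negPf ->.
  by rewrite scale0r.
Qed.

Lemma vertexn {R : realType} (n : nat) (rho phi : R) : (0 < n)%N ->
  vertex n rho phi n = vertex n rho phi 0.
Proof.
move=> n0; rewrite /vertex mulr0 mul0r addr0 mulfK ?pnatr_eq0 -?lt0n //.
have -> : phi + 2 * pi = phi + 2 * pi * 1%:~R by rewrite mulr1.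
by rewrite cosD2pi_int sinD2pi_int.
Qed.

Lemma polygon_sub_regular_ngon {R : realType} (n : nat) (rho phi : R) :
  (3 <= n)%N -> 0 < rho -> regular_ngon n rho phi 0 ->
  polygon n phi (rho * cos (pi / n%:R)) `<=` regular_ngon n rho phi.
Proof.
move=> n3 rho0 P0; have /andP[a0 api] := @pi_div_bounds R n n3.
set a := pi / n%:R in a0 api *.
have n0 : (0 < n)%N by rewrite (ltn_trans _ n3).
have sa : 0 < sin a.
  by apply: sin_gt0_pi; apply/andP; split; have := pi_gt0 R; lra.
have ca : 0 < cos a by apply: cos_gt0_pihalf; apply/andP; split; lra.
rewrite polygon_sectors //; last by rewrite mulr_ge0 ?ltW.
move=> p [->//|]; rewrite -(bigcup_mkord n (fun k => sector n phi _ k)).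
move=> [k /= kn] /(sectorP _ _ _ _ _ n3)[r [d [r0 /andP[d1 d2] rd ->]]].
rewrite -/a in d1 d2.
have vk : regular_ngon n rho phi (polar rho (normal_angle n phi k - a)).
  by rewrite -vertex_polar; exact: vertex_regular_ngon.
have vSk : regular_ngon n rho phi (polar rho (normal_angle n phi k + a)).
  (* The last side closes up at vertex 0. *)
  rewrite -vertexS_polar; move: kn; rewrite leq_eqVlt => /predU1P[->|kn].
    by rewrite vertexn //; exact: vertex_regular_ngon.
  exact: vertex_regular_ngon.
set b := normal_angle n phi k in vk vSk *.
(* [A] and [B] are the components of the point along and across the normal, relative to the apothem
   and to half a side. The weights [(A - B) / 2] and [(A + B) / 2] on the two vertices of the side
   add up to [A <= 1], and have the signs of [sin (a - d)] and [sin (a + d)]. *)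
pose A := r * cos d / (rho * cos a); pose B := r * sin d / (rho * sin a).
have E : polar r (b + d) =
    ((A - B) / 2) *: polar rho (b - a) + ((A + B) / 2) *: polar rho (b + a).
  rewrite !scale_pairE /polar /A /B; move: (b) => b'.
  by congr pair; rewrite /= !(cosD, cosB, sinD, sinB) ?cosN ?sinN;
    field; rewrite !gt_eqF.
have A1 : A <= 1 by rewrite /A ler_pdivrMr ?mulr_gt0 // mul1r.
have AB : A - B = r * sin (a - d) / (rho * sin a * cos a).
  by rewrite sinB /A /B; field; rewrite !gt_eqF.
have AB' : A + B = r * sin (a + d) / (rho * sin a * cos a).
  by rewrite sinD /A /B; field; rewrite !gt_eqF.
have den : 0 <= rho * sin a * cos a by rewrite !mulr_ge0 // ltW.
have s1 : 0 <= sin (a - d) by apply: sin_ge0_pi; apply/andP; split; lra.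
have s2 : 0 <= sin (a + d) by apply: sin_ge0_pi; apply/andP; split; lra.
rewrite E; apply: regular_ngon_comb => //; last by lra.
  by rewrite AB divr_ge0 // divr_ge0 // mulr_ge0 // ltW.
by rewrite AB' divr_ge0 // divr_ge0 // mulr_ge0 // ltW.
Qed.

(** The point of the circle in the direction of a normal lies in the corresponding half-plane,
    whence [<=]. Conversely a contact point lies on the line of a side, so its norm [r] is at least
    the distance from that line to the origin. *)
Lemma inscribed_circle_inradius {R : realType} (n : nat) (rho phi r : R) :
  (3 <= n)%N -> 0 < r -> 0 < rho -> inscribed_circle n rho phi r ->
  r = rho * cos (pi / n%:R).
Proof.
move=> n3 r0 rho0 [sub tangent].
have /andP[a0 api] := @pi_div_bounds R n n3.
have n0 : (0 < n)%N by rewrite (ltn_trans _ n3).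
pose k := Ordinal n0; set b := normal_angle n phi k.
have cs := cos2Dsin2 b.
apply/eqP; rewrite eq_le; apply/andP; split.
  have /sub/(regular_ngon_sub_polygon _ _ _ (ltW rho0))/(_ k) :
    circle r (polar r b).
    rewrite /circle /polar /=.
    by rewrite !exprMn -mulrDr cs mulr1.
  rewrite /polar /= -/b (_ : _ + _ = r * (cos b ^+ 2 + sin b ^+ 2));
    last by ring.
  by rewrite cs mulr1.
have [p [[[t _ pE] pr] _]] := tangent k.
have pb : p.1 * cos b + p.2 * sin b = rho * cos (pi / n%:R).
  rewrite pE vertex_polar vertexS_polar -/b !scale_pairE /polar /=;
    move: (b) cs => b' cs.
  rewrite !(cosB, sinB, cosD, sinD).
  transitivity (rho * cos (pi / n%:R) * (cos b' ^+ 2 + sin b' ^+ 2));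
    last by rewrite cs mulr1.
  ring.
have ca : 0 < cos (pi / n%:R) :> R.
  by apply: cos_gt0_pihalf; apply/andP; split; lra.
rewrite -pb -ler_sqr ?nnegrE ?(ltW r0) //; last by rewrite pb mulr_ge0 // ltW.
rewrite -pr; rewrite -[leRHS]mulr1 -cs.
(* Lagrange's identity: this square is the squared norm of [p] minus the square of its component
   along the normal. *)
have := sqr_ge0 (p.1 * sin b - p.2 * cos b); rewrite -subr_ge0.
by set x := (X in 0 <= X) => x0; rewrite (_ : _ - _ = x) // /x; ring.
Qed.

Lemma regular_ngon_polygon {R : realType} (n : nat) (rho phi r : R) :
  (3 <= n)%N -> 0 < r -> 0 < rho -> inscribed_circle n rho phi r ->
  regular_ngon n rho phi = polygon n phi r.
Proof.
move=> n3 r0 rho0 ins.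
have rE := inscribed_circle_inradius _ _ _ _ n3 r0 rho0 ins.
apply/seteqP; split.
  by rewrite rE; exact: regular_ngon_sub_polygon (ltW _).
rewrite rE; apply: polygon_sub_regular_ngon => //.
(* The origin is in the hull as the midpoint of two opposite points of the circle. *)
have [sub _] := ins.
have [w1 [w1p w11 w1E]] : regular_ngon n rho phi (r, 0).
  by apply: sub; rewrite /circle /= expr0n addr0.
have [w2 [w2p w21 w2E]] : regular_ngon n rho phi (- r, 0).
  by apply: sub; rewrite /circle /= expr0n addr0 sqrrN.
exists (fun k => 2^-1 * w1 k + 2^-1 * w2 k); split.
- by move=> k; rewrite addr_ge0 ?mulr_ge0 ?invr_ge0.
- by rewrite big_split /= -!mulr_sumr w11 w21; lra.
- under eq_bigr do rewrite scalerDl -!scalerA.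
  rewrite big_split /= -!scaler_sumr -w1E -w2E.
  by rewrite !scale_pairE; congr pair; rewrite /=; lra.
Qed.

(** * The sections of the solid and its volume *)

(** All areas are finite and share the nonzero factor [n * tan (pi / n)], so their equality reads
    [(lam * r) ^+ 2 = r ^+ 2 - z ^+ 2], and [0 <= lam] selects the nonnegative root. *)
Lemma solid_polygonE {R : realType} (n : nat) (phi r : R) : (3 <= n)%N ->
    0 < r ->
  solid (polygon n phi r) r = [set q | 0 <= q.2 <= r /\
    polygon n phi (Num.sqrt (r ^+ 2 - q.2 ^+ 2)) q.1].
Proof.
move=> n3 r0; have r0' := ltW r0.
have rn0 : r != 0 by rewrite gt_eqF.
have t0 := tan_pi_div_gt0 n n3 : 0 < tan (pi / n%:R) :> R.
have nt0 : n%:R * tan (pi / n%:R) != 0 :> R.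
  by rewrite mulf_neq0 ?(gt_eqF t0) // pnatr_eq0 -lt0n (ltn_trans _ n3).
have areaE (lam z : R) : 0 <= lam -> 0 <= z <= r ->
    area (homothety lam (polygon n phi r)) =
      (area (polygon n phi r) -
       area (homothety (z / r) (polygon n phi r)))%E <->
    lam * r = Num.sqrt (r ^+ 2 - z ^+ 2).
  move=> l0 /andP[z0 zr]; have lr0 : 0 <= lam * r by rewrite mulr_ge0.
  rewrite !homothety_polygon ?divr_ge0 // divfK // !area_polygon // -EFinB.
  rewrite -!(mulrAC n%:R (tan _)) -mulrBr.
  split=> [[/(mulfI nt0) <-]|->]; first by rewrite sqrtr_sqr ger0_norm.
  by rewrite sqr_sqrtr // subr_ge0 ler_sqr ?nnegrE.
apply/seteqP; split=> -[p z] [/= zr].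
  by move=> [lam [l0 /(areaE _ _ l0 zr) E]]; rewrite homothety_polygon // E.
move=> H.
split=> //=; exists (Num.sqrt (r ^+ 2 - z ^+ 2) / r).
have l0 : 0 <= Num.sqrt (r ^+ 2 - z ^+ 2) / r by rewrite divr_ge0 // sqrtr_ge0.
split=> //; first by apply/(areaE _ _ l0 zr); rewrite divfK.
by rewrite homothety_polygon // divfK.
Qed.

Lemma measurable_solid_polygon {R : realType} (n : nat) (phi r : R) :
  (3 <= n)%N -> 0 < r -> measurable (solid (polygon n phi r) r).
Proof.
move=> n3 r0; rewrite solid_polygonE //.
rewrite (_ : mkset _ = [set q : R * R * R | 0 <= q.2] `&` [set q | q.2 <= r] `&`
   \bigcap_(k in [set: 'I_n]) [set q | q.1.1 * cos (normal_angle n phi k) +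
       q.1.2 * sin (normal_angle n phi k) <= Num.sqrt (r ^+ 2 - q.2 ^+ 2)]);
  last first.
  apply/seteqP; split=> q /=.
    by case=> /andP[? ?] H; split=> // k _; exact: H.
  by move=> [[? ?] H]; split; [apply/andP|move=> k; exact: H].
have m1 : measurable_fun setT (fun q : R * R * R => q.1.1).
  exact: measurableT_comp.
have m2 : measurable_fun setT (fun q : R * R * R => q.1.2).
  exact: measurableT_comp.
apply: measurableI.
  by apply: measurableI; exact: measurable_set_ler.
apply: fin_bigcap_measurable => [|k _]; first exact: finite_finset.
apply: measurable_set_ler.
  by apply: measurable_funD; apply: measurable_funM.
apply: measurableT_comp.
  by apply: continuous_measurable_fun; exact: sqrt_continuous.
by apply: measurable_funB => //; exact: measurable_funX.
Qed.

Lemma volume_solid_polygon {R : realType} (n : nat) (phi r : R) :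
  (3 <= n)%N -> 0 < r ->
  volume (solid (polygon n phi r) r) =
    (2 / 3 * n%:R * r ^+ 3 * tan (pi / n%:R))%:E.
Proof.
move=> n3 r0; rewrite volume_ysection; last exact: measurable_solid_polygon.
rewrite solid_polygonE //.
(* [P] is the primitive, vanishing at 0, of the section area [n * t * (r ^+ 2 - z ^+ 2)]; the factor
   2/3 of the volume is [1 - 3^-1]. *)
set t := tan _; set P := (n%:R * t) *: (r ^+ 2 *: 'X - 3^-1 *: 'X^3).
transitivity (\int[lebesgue_measure]_(z in `[0%R, r]) (P^`().[z])%:E)%E;
  last first.
  rewrite integral_deriv_poly ?(ltW r0) // /P; congr (_%:E).
  by rewrite !(hornerZ, hornerD, hornerN, hornerX, hornerXn); field.
rewrite [RHS]integral_mkcond; apply: eq_integral => z _.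
rewrite patchE; case: ifPn => [|].
  rewrite inE /= in_itv /= => zr; case/andP: (zr) => z0 zr'.
  rewrite (_ : ysection _ z = polygon n phi (Num.sqrt (r ^+ 2 - z ^+ 2))).
    rewrite area_polygon ?sqrtr_ge0 // sqr_sqrtr;
      last by rewrite subr_ge0 ler_sqr ?nnegrE // ltW.
    congr (_%:E); rewrite /P derivZ derivB !derivZ derivX derivXn.
    by rewrite !(hornerZ, hornerD, hornerN, hornerMn, hornerXn, hornerC);
      rewrite -/t; field.
  by rewrite ysectionE; apply/seteqP; split=> p /=; [case|].
rewrite notin_setE /= in_itv /= => nz.
rewrite (_ : ysection _ z = set0); first exact: measure0.
by rewrite ysectionE; apply/seteqP; split => // p [].
Qed.

Theorem mainTheorem3 (R : realType) (n : nat) (r rho phi : R)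
    (hn : (3 <= n)%N) (hr : 0 < r) (hrho : 0 < rho)
    (hinscribed : inscribed_circle n rho phi r) :
  volume (solid (regular_ngon n rho phi) r) =
    (2 / 3 * n%:R * r ^+ 3 * tan (pi / n%:R))%:E.
Proof.
rewrite (regular_ngon_polygon n rho phi r) //.
exact: volume_solid_polygon.
Qed.
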